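(* Let $X=\langle a,b\rangle\langle c,d\rangle$ be a bidihedral group, where $\langle a,b\rangle\cong D_{2n}$ and $\langle c,d\rangle\cong D_{2m}$ with $a^n=b^2=1$, $a^b=a^{-1}$, $c^m=d^2=1$, $c^d=c^{-1}$. Then one of the following holds. (1) $X$ is an exact bidihedral group. (2) $1\ne\langle a,b\rangle\cap\langle c,d\rangle\le\langle c\rangle$, and one of the following holds: (a) $X/(\langle a,b\rangle\cap\langle c,d\rangle)$ is an exact bidihedral group or an exact product group of a dihedral group and a cyclic group; (b) $X$ is an exact product group of a dihedral group and a cyclic group. (3) $\langle a,b\rangle\cap\langle c,d\rangle=\langle c_1,d_1\rangle\le\langle c,d\rangle$ for some $d_1\in\langle c,d\rangle\setminus\langle c\rangle$ and $c_1\in\langle c\rangle$ with $\langle c_1\rangle=\langle a,b\rangle\cap\langle c\rangle$, and one of the following holds: (a) $X/\langle c_1\rangle$ is either an exact bidihedral group or a dihedral group; (b) $X$ is an exact product group of a dihedral group and a cyclic group; (c) $X=(\langle c\rangle\rtimes\langle a^2\rangle).\langle a\rangle$ with $o(a)=4$; (d) $X=\langle a,b\rangle\langle c^2\rangle$ is an exact product group of the dihedral group $\langle a,b\rangle$ and the cyclic group $\langle c^2\rangle$.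
   Context: All groups are finite. $x^y=y^{-1}xy$, and $o(x)$ is the order of $x$. $D_{2n}=\langle a,b\mid a^n=1,\ b^2=1,\ a^b=a^{-1}\rangle$ is the dihedral group of order $2n$, and $D_{2m}=\langle c,d\mid c^m=1,\ d^2=1,\ c^d=c^{-1}\rangle$ the one of order $2m$, with $n,m\ge2$ (so $D_4\cong C_2\times C_2$ counts as dihedral). A group is bidihedral if it is a product of two dihedral subgroups, and exact bidihedral if it is such a product with the two dihedral subgroups intersecting trivially; in (1), for the given $X=\langle a,b\rangle\langle c,d\rangle$, this means $\langle a,b\rangle\cap\langle c,d\rangle=1$. A group is an exact product group of a dihedral group and a cyclic group if it equals $AB$ with $A$ a dihedral subgroup, $B$ a cyclic subgroup and $A\cap B=1$. Writing a quotient $X/N$ includes the assertion that $N\unlhd X$. $G\rtimes H$ is the internal semidirect product of subgroups: $GH$ with $G\unlhd GH$ and $G\cap H=1$. For subgroups $G,H$ of $X$, $A=G.H$ means that $A=GH$ is a subgroup, $G\unlhd A$, and for any element $h\in H$ there exists an integer $\ell$ such that $h^\ell\in G$. *)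

(* Defs.v *)
From HB Require Import structures.
From mathcomp Require Import all_boot all_order all_algebra all_fingroup all_solvable.
Set Implicit Arguments.
Unset Strict Implicit.
Unset Printing Implicit Defensive.
Local Open Scope group_scope.

(* n = 2 is allowed, so the Klein four-group 'D_4 counts as dihedral. *)
Definition dihedral (gT : finGroupType) (G : {set gT}) : Prop :=
  exists2 n : nat, (1 < n)%N & G \isog 'D_(n.*2).

Definition exact_product (gT : finGroupType) (X A B : {set gT}) : Prop :=
  X = A * B /\ A :&: B = 1.

Definition exact_bidihedral (gT : finGroupType) (X : {set gT}) : Prop :=
  exists A B : {group gT}, [/\ dihedral A, dihedral B & exact_product X A B].

(* The cyclic factor may be trivial. *)
Definition exact_dihedral_cyclic (gT : finGroupType) (X : {set gT}) : Prop :=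
  exists A B : {group gT}, [/\ dihedral A, cyclic B & exact_product X A B].

Definition expgz (gT : finGroupType) (x : gT) (l : int) : gT :=
  match l with Posz k => x ^+ k | Negz k => x ^- k.+1 end.

(* A = G.H; the last clause is the usual definition taken literally, and holds
   for every h already with l = 0. *)
Definition dot_product (gT : finGroupType) (A G H : {group gT}) : Prop :=
  [/\ A :=: G * H, G <| A & forall h, h \in H -> exists l : int, expgz h l \in G].

(* Main.v *)
Require Import Defs.
From HB Require Import structures.
From mathcomp Require Import all_boot all_order all_algebra all_fingroup all_solvable.
Set Implicit Arguments.
Unset Strict Implicit.
Unset Printing Implicit Defensive.
Local Open Scope group_scope.

(* Write A = <a,b>, B = <c,d>, D = A n B.  If D <= <c>, then either D <= <a>, so
   D is normal and one passes to X / D, or D has order 2, is generated by a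
   reflection of A, and X = B<a> is exact.
   If D is not in <c>, put Z = A n <c>; then X = A<c> and |D| = 2|Z|.
   - Z not in <a>: Z is generated by the involution of <c>, which inverts a, and
     symmetrically the involution of <a> inverts c.  If |c|/2 or |a|/2 is odd,
     <c^2> or <a^2> is a complement.  Otherwise Ito's identity for X = <a><c>
     makes a^2 and c^2 commute, whence a^4 = 1 and X = (<c> : <a^2>).<a>.
   - Z <= <a>, and |<a> : Z| or |<c> : Z| is at most 2: X is an exact product.
     If one of the indices is even and both exceed 2, halving the corresponding
     dihedral group gives an exact bidihedral factorization of X / Z.  If both
     are odd, a and c commute, and since d inverts both, a cyclic decomposition
     of <a,c> gives an exact factorization of X. *)

(** * Dihedral groups via their rotation subgroups *)

(* If |C| > 1, then G is dihedral and C is its group of rotations.  The case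
   |C| = 1 is allowed so that the notion passes to quotients. *)
Definition rotation_subgroup (gT : finGroupType) (G C : {group gT}) : Prop :=
  [/\ C \subset G, cyclic C, #|G| = #|C|.*2
    & forall t, t \in G -> t \notin C -> t ^+ 2 = 1].

Section Rotations.

Variables (gT : finGroupType) (G C : {group gT}).

Lemma rotations_ex : rotation_subgroup G C -> exists2 t, t \in G & t \notin C.
Proof.
case=> sCG _ oG _; apply/subsetPn; apply/negP => /subset_leq_card.
by rewrite oG -addnn -[X in (_ <= X)%N]addn0 leq_add2l leqNgt cardG_gt0.
Qed.

Lemma rotations_conj t x :
  rotation_subgroup G C -> t \in G -> t \notin C -> x \in C -> x ^ t = x^-1.
Proof.
case=> sCG _ _ sq1 Gt notCt Cx.
have tt : t * t = 1 by rewrite -(sq1 t).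
have xt : x * t * (x * t) = 1.
  by rewrite -(sq1 (x * t)) ?groupMl // (subsetP sCG).
have tV : t^-1 = t by apply/eqP; rewrite eq_invg_mul tt.
apply/eqP; rewrite eq_sym eq_invg_mul /conjg tV.
by rewrite -xt !mulgA.
Qed.

Lemma rotations_coset t : rotation_subgroup G C -> t \in G -> t \notin C ->
  G :\: C = C :* t.
Proof.
case=> sCG _ oG _ Gt notCt; apply/eqP; rewrite eq_sym eqEcard card_rcoset.
have := cardsID C G; rewrite (setIidPr sCG) oG -addnn => /addnI ->.
rewrite leqnn andbT; apply/subsetP => _ /rcosetP[x Cx ->].
by rewrite inE groupMl // notCt groupMr // (subsetP sCG).
Qed.

Lemma rotations_mul t : rotation_subgroup G C -> t \in G -> t \notin C ->
  G :=: C * <[t]>.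
Proof.
move=> rot Gt notCt; have [sCG _ _ _] := rot.
apply/eqP; rewrite eqEsubset mul_subG ?cycle_subG // andbT.
apply/subsetP => x Gx; have [Cx | notCx] := boolP (x \in C).
  by rewrite -(mulg1 x) mem_mulg.
have: x \in G :\: C by rewrite inE notCx.
rewrite (rotations_coset rot Gt) // => /rcosetP[y Cy ->].
by rewrite mem_mulg ?cycle_id.
Qed.

Lemma rotations_sub (H : {group gT}) : rotation_subgroup G C -> H \subset G ->
  ~~ (H \subset C) -> rotation_subgroup H (H :&: C).
Proof.
move=> rot sHG /subsetPn[t Ht notCt]; have [sCG cycC oG sq1] := rot.
have Gt := subsetP sHG t Ht.
split; rewrite ?subsetIl ?(cyclicS (subsetIr _ _)) //.
  rewrite -(cardsID C H) -addnn; congr (_ + _)%N.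
  have -> : H :\: C = (H :&: C) :* t.
    apply/setP => x; rewrite mem_rcoset !inE groupMr ?groupV // andbC.
    case Hx: (x \in H) => //=; have Gx := subsetP sHG x Hx.
    have := congr1 (fun S : {set gT} => x \in S) (rotations_coset rot Gt notCt).
    by rewrite mem_rcoset inE Gx andbT.
  by rewrite card_rcoset.
move=> s Hs; rewrite inE Hs /= => notCs; exact: sq1 (subsetP sHG s Hs) notCs.
Qed.

Lemma rotations_join t : cyclic C -> t \notin C -> t ^+ 2 = 1 ->
  {in C, forall x, x ^ t = x^-1} -> rotation_subgroup (C <*> <[t]>) C.
Proof.
move=> cycC notCt t21 invt.
have nCt : <[t]> \subset 'N(C).
  rewrite cycle_subG inE; apply/subsetP => _ /imsetP[x Cx ->].
  by rewrite invt // groupV.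
have defG : C <*> <[t]> = C * <[t]> by rewrite norm_joinEr.
have ot : #[t] = 2.
  by apply: nt_prime_order => //; apply: contraNneq notCt => ->.
have tV : t^-1 = t by rewrite invg_expg ot.
split=> //; rewrite ?joing_subl //=.
  rewrite defG TI_cardMg -?orderE ?ot ?muln2 // setIC prime_TIg -?orderE ?ot //.
  by rewrite cycle_subG.
move=> s; rewrite defG => /mulsgP[x y Cx]; rewrite cycle2g // => /set2P[] -> ->.
  by rewrite mulg1 Cx.
by rewrite groupMl // notCt expgS expg1 -mulgA -{1}tV -conjgE invt ?mulgV.
Qed.

(** [C] has index 2, hence is normal, and every subgroup of a cyclic group is characteristic in
    it. *)
Lemma rotations_normal (N : {group gT}) :
  rotation_subgroup G C -> N \subset C -> N <| G.
Proof.
case=> sCG cycC oG _ sNC; have nCG : C <| G.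
  by apply: index2_normal => //; rewrite -divgS // oG -muln2 mulKn ?cardG_gt0.
by apply: char_normal_trans nCG; rewrite sub_cyclic_char.
Qed.

Lemma rotations_quotient (N : {group gT}) : rotation_subgroup G C -> N \subset C ->
  rotation_subgroup (G / N) (C / N).
Proof.
move=> rot sNC; have nNG := rotations_normal rot sNC.
have [sCG cycC oG sq1] := rot; have nNC := normalS sNC sCG nNG.
split; rewrite ?quotientS ?quotient_cyclic //.
  rewrite -!divg_normal // oG -!muln2 -(Lagrange sNC) -mulnA.
  by rewrite !mulKn ?cardG_gt0.
move=> _ /morphimP[x Nx Gx ->] notCx; rewrite -morphX //= sq1 ?morph1 //.
by apply: contra notCx => Cx; rewrite mem_quotient.
Qed.

(** Two distinct involutions generate a dihedral group. Here they are a reflection [t] and [c * t],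
    which differ because [c] generates a nontrivial group; the Klein four-group needs no separate
    treatment. *)
Lemma rotations_dihedral : rotation_subgroup G C -> (1 < #|C|)%N -> dihedral G.
Proof.
move=> rot C_gt1; have [sCG /cyclicP[c defC] oG sq1] := rot.
have [t Gt notCt] := rotations_ex rot.
have Cc : c \in C by rewrite defC cycle_id.
have order2 s : s \in G -> s \notin C -> #[s] = 2.
  move=> Gs notCs; apply: nt_prime_order; rewrite ?sq1 //.
  by apply: contraNneq notCs => ->.
have Gc := subsetP sCG c Cc.
have defG : <<[set t; c * t]>> = G.
  apply/eqP; rewrite eqEsubset gen_subG subUset !sub1set Gt groupM //=.
  rewrite (rotations_mul rot Gt notCt) defC mul_subG //.
    by rewrite cycle_subG -{1}(mulgK t c) groupM ?groupV ?mem_gen ?set21 ?set22.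
  by rewrite cycle_subG mem_gen ?set21.
exists #|C| => //; rewrite -oG; case: _ / defG.
apply: involutions_gen_dihedral; first exact: order2.
  by apply: order2; rewrite groupMl.
by rewrite -divg_eq mulgV eq_sym -order_gt1 orderE -defC.
Qed.

End Rotations.

(** * Two criteria for elements to commute *)

(** [chi] is the sign of the permutation of [G] given by right multiplication. An involution has no
    fixed point there, so it is a product of [#|G|./2] disjoint transpositions. *)
Lemma regular_sign (gT : finGroupType) (G : {group gT}) :
  exists chi : gT -> bool, {in G &, forall x y, chi (x * y) = chi x (+) chi y}
    /\ {in G, forall x, #[x] = 2 -> chi x = odd (#|G|./2)}.
Proof.
pose to := 'R%act : {action subg_of G &-> subg_of G}.
exists (fun x => actperm to (subg G x)); split=> [x y Gx Gy|x Gx ox].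
  by rewrite subgM // actpermM ?inE // odd_permM.
have osx : #[subg G x] = 2 by rewrite order_injm ?injm_subg.
have orbE y : porbit (actperm to (subg G x)) y = y *: <[subg G x]>.
  by rewrite porbit_actperm ?inE // orbitR.
have part : partition (porbits (actperm to (subg G x))) [set: subg_of G].
  have := orbit_partition (to := to) (G := <[subg G x]>) (S := [set: subg_of G]).
  have -> : [set orbit to <[subg G x]> y | y in [set: subg_of G]]
     = porbits (actperm to (subg G x)).
    apply/setP=> S; apply/imsetP/imsetP=> -[y _ ->]; exists y => //;
    by rewrite orbE orbitR.
  apply; apply/subsetP=> y _; rewrite !inE /=; apply/subsetP => z _.
  by rewrite !inE.
have card2 : {in porbits (actperm to (subg G x)), forall S : {set _}, #|S| = 2}.
  by move=> _ /imsetP[y _ ->]; rewrite orbE card_lcoset.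
have := card_uniform_partition card2 part.
rewrite cardsT /odd_perm => ->; rewrite oddM andbF addFb.
have -> : #|G| = (#|porbits (actperm to (subg G x))| * 2)%N.
  by rewrite -(card_uniform_partition card2 part) cardsT card_sub.
by rewrite muln2 doubleK.
Qed.
(* Here d has centralizer of order 2, so its conjugates are exactly the elements
   that are odd in the regular representation.  As d * (a * c) is odd, it is an
   involution. *)
Lemma odd_rotations_commute (gT : finGroupType)
    (X A : {group gT}) (a c d : gT) :
  rotation_subgroup A <[a]> -> d \in A -> d \notin <[a]> -> X :=: A * <[c]> ->
  A :&: <[c]> = 1 -> c ^ d = c^-1 -> odd #[a] -> odd #[c] -> commute a c.
Proof.
move=> rotA Ad notad defX tiAc cd odd_a odd_c.
have [saA _ oA sq1] := rotA; have d2 := sq1 d Ad notad.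
have od : #[d] = 2.
  by apply: nt_prime_order => //; apply: contraNneq notad => ->.
have dV : d^-1 = d by rewrite invg_expg od.
have oX : #|X| = (#[a] * #[c]).*2.
  by rewrite defX TI_cardMg // oA -!orderE doubleMl.
have sAX : A \subset X by rewrite defX mulG_subl.
have Xc : c \in X by rewrite -cycle_subG defX mulG_subr.
have Xa : a \in X by rewrite (subsetP sAX) // (subsetP saA) ?cycle_id.
have Xd := subsetP sAX d Ad.
have ad : a ^ d = a^-1 by apply: (rotations_conj rotA); rewrite ?cycle_id.
have [chi [chiM chi2]] := regular_sign X.
have chi_d : chi d by rewrite chi2 // oX doubleK oddM odd_a odd_c.
have chi1 : chi 1 = false by have := chiM 1 1; rewrite mulg1 addbb => ->.
have chiX x n : x \in X -> chi (x ^+ n) = odd n && chi x.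
  move=> Xx; elim: n => // n IHn; rewrite expgS chiM ?groupX // IHn /=.
  by case: (odd n); case: (chi x).
have chi_odd x : x \in X -> odd #[x] -> chi x = false.
  by move=> Xx odd_x; have := chiX x #[x] Xx; rewrite expg_order chi1 odd_x.
(* If [u * v] commutes with [d], where [u] is in [A] and [v] in [<[c]>], then
   [v ^+ 2 = u^-1 * u ^ d] lies in [A :&: <[c]> = 1], so [v = 1] since [c] has odd order. The
   rotation part of [u] is then fixed and inverted by [d], so it is trivial too. *)
have cent_d : 'C_X[d] \subset <[d]>.
  apply/subsetP => x; rewrite defX inE => /andP[/mulsgP[u v Au]].
  case/cycleP=> j ->{v} ->{x} /cent1P/commgP/conjg_fixP.
  rewrite conjMg conjXg cd expVgn => uv.
  have ud : u ^ d = u * c ^+ j * c ^+ j by rewrite -uv mulgKV.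
  have vv : c ^+ j * c ^+ j = u^-1 * u ^ d by rewrite ud !mulgA mulVg mul1g.
  have v1 : c ^+ j = 1.
    have : (c ^+ j) ^+ 2 \in A :&: <[c]>.
      apply/setIP; split; last by rewrite !groupX ?cycle_id.
      by rewrite expgS expg1 vv groupM ?groupV ?groupJ.
    rewrite tiAc => /set1gP/eqP.
    rewrite -expgM -order_dvdn Gauss_dvdl ?coprimen2 // order_dvdn => /eqP //.
  move: ud {uv vv}; rewrite v1 !mulg1.
  move: Au; rewrite (rotations_mul rotA Ad notad) => /mulsgP[_ y /cycleP[i ->]].
  rewrite cycle2g // => /set2P yd ->{u}.
  have -> : (a ^+ i * y) ^ d = a ^- i * y.
    rewrite conjMg conjXg ad expVgn; congr (_ * _).
    by case: yd => ->; rewrite ?conj1g // conjgE ?mulKg.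
  move/mulIg => ai; have a1 : a ^+ i = 1.
    have /eqP : (a ^+ i) ^+ 2 = 1 by rewrite expgS expg1 -{1}ai mulVg.
    by rewrite -expgM -order_dvdn Gauss_dvdl ?coprimen2 // order_dvdn => /eqP.
  by rewrite a1 mul1g; apply/set2P.
have class_d : d ^: X = [set x in X | chi x].
  apply/eqP; rewrite eqEcard; apply/andP; split.
    apply/subsetP => _ /imsetP[x Xx ->]; rewrite inE groupJ //=.
    by rewrite chi2 ?groupJ ?orderJ // -(chi2 d).
  (* Right multiplication by [d] changes the sign, so at most half of [X] is odd, while the class of
     [d] fills at least half of [X]. *)
  have : (#|[set x in X | chi x]|.*2 <= #|X|)%N.
    rewrite -addnn -[X in (X + _)%N](card_rcoset _ d) -cardsUI.
    rewrite [X in (_ + X)%N](_ : _ = 0) ?addn0.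
      apply: subset_leq_card; rewrite subUset; apply/andP; split; last first.
        by apply/subsetP => x; rewrite inE => /andP[].
      by apply/subsetP => _ /rcosetP[x + ->]; rewrite inE => /andP[Xx _];
      rewrite groupM.
    apply: eq_card0 => x; rewrite inE; apply/negP => /andP[/rcosetP[y + ->]].
    by rewrite !inE => /andP[Xy cy] /andP[_]; rewrite chiM // cy chi_d.
  rewrite -(Lagrange (subsetIl X 'C[d])) index_cent1.
  have := subset_leq_card cent_d; rewrite -orderE od => /leq_trans leC.
  move/leq_trans/(_ (leq_mul (leC _ (leqnn 2)) (leqnn _))).
  by rewrite mul2n leq_double.
have : d * (a * c) \in d ^: X.
  rewrite class_d inE !groupM //= !chiM ?groupM // chi_d.
  by rewrite !chi_odd.
case/imsetP=> x Xx dac; apply/commgP; apply/eqP.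
(* This square equals [(a * c) ^ d * (a * c) = a^-1 * c^-1 * a * c], the commutator of [a] and
   [c]. *)
have : (d * (a * c)) ^+ 2 = 1 by rewrite dac -conjXg d2 conj1g.
rewrite expgS expg1 => <-.
have -> : d * (a * c) * (d * (a * c)) = (a * c) ^ d * (a * c).
  by rewrite conjgE dV !mulgA.
by rewrite conjMg ad cd commgEl conjgE !mulgA.
Qed.

(* The computation behind Ito's theorem that a product of two abelian groups is
   metabelian. *)
Lemma abelian_mul_commute_comm (gT : finGroupType)
    (G A B : {group gT}) x x' y y' :
  abelian A -> abelian B -> G :=: A * B -> x \in A -> x' \in A ->
  y \in B -> y' \in B -> commute [~ x, y] [~ x', y'].
Proof.
move=> /centsP cAA /centsP cBB defG Ax Ax' By By'.
have cAB : commute (gval A) B.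
  by apply/comm_group_setP; rewrite -defG groupP.
have /subsetP sAG : A \subset G by rewrite defG mulG_subl.
have /subsetP sBG : B \subset G by rewrite defG mulG_subr.
have : y ^ x'^-1 \in G by rewrite groupJ ?groupV; auto.
rewrite defG => /mulsgP[x2 y2 Ax2 By2 yx].
have : x ^ y'^-1 \in G by rewrite groupJ ?groupV; auto.
rewrite defG cAB => /mulsgP[y3 x3 By3 Ax3 xy].
have commA u v w : u \in A -> v \in A -> [~ u, v * w] = [~ u, w].
  move=> Au Av; rewrite commgMJ.
  by have /commgP/eqP -> := cAA u Au v Av; rewrite conj1g mulg1.
have commB u v w : u \in B -> w \in B -> [~ u * v, w] = [~ v, w].
  move=> Bu Bw; rewrite commMgJ.
  by have /commgP/eqP -> := cBB u Bu w Bw; rewrite conj1g mul1g.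
have fixA u v : u \in A -> v \in A -> u ^ v = u.
  by move=> Au Av; apply/conjg_fixP/commgP/cAA.
have fixB u v : u \in B -> v \in B -> u ^ v = u.
  by move=> Bu Bv; apply/conjg_fixP/commgP/cBB.
(* Conjugation by [x'^-1] and [y'^-1] in either order takes [[~ x, y]] to the same element, so the
   quotient of the two conjugators, which is [[~ x', y']], centralizes it. *)
have e1 : [~ x, y] ^ (x'^-1 * y'^-1) = [~ x3, y2].
  by rewrite conjgM conjRg (fixA x) ?groupV // yx commA // conjRg xy (fixB y2)
    ?groupV // commB.
have e2 : [~ x, y] ^ (y'^-1 * x'^-1) = [~ x3, y2].
  by rewrite conjgM conjRg (fixB y) ?groupV // xy commB // conjRg (fixA x3)
    ?groupV // yx commA.
apply/commgP/conjg_fixP.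
have -> : [~ x', y'] = x'^-1 * y'^-1 * (y'^-1 * x'^-1)^-1.
  by rewrite commgEl conjgE invMg !invgK !mulgA.
by rewrite conjgM e1 -e2 conjgK.
Qed.

(** * Exact factorizations without a shared reflection *)

Lemma exact_productI (gT : finGroupType) (X A B : {group gT}) :
  A \subset X -> B \subset X -> A :&: B = 1 -> (#|X| <= #|A| * #|B|)%N ->
  exact_product X A B.
Proof.
move=> sAX sBX tiAB leX; split=> //; apply/eqP.
by rewrite eq_sym eqEcard mul_subG // TI_cardMg.
Qed.

(** [G] is abelian on two generators, hence a direct product of cyclic groups [<[x]>] and [<[y]>]
    with [x] nontrivial. As [d] inverts all of [G], [x] and [d] generate a dihedral group, and
    [<[y]>] complements it. *)
Lemma inverted_abelian_exact (gT : finGroupType)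
    (X G : {group gT}) (a c d : gT) :
  a != 1 -> commute a c -> a ^ d = a^-1 -> c ^ d = c^-1 -> d ^+ 2 = 1 ->
  G :=: <[a]> * <[c]> -> d \notin G -> X :=: G * <[d]> ->
  exact_dihedral_cyclic X.
Proof.
move=> nta ac ad cd d21 defG notGd defX.
have Ga : a \in G by rewrite -cycle_subG defG mulG_subl.
have invd : {in G, forall g, g ^ d = g^-1}.
  move=> g; rewrite defG => /mulsgP[_ _ /cycleP[i ->] /cycleP[j ->] ->].
  rewrite conjMg !conjXg ad cd !expgVn -invMg; congr (_ ^-1).
  by apply: commuteX; apply: commute_sym; apply: commuteX; apply: commute_sym.
have cGG : abelian G.
  rewrite defG abelianM !cycle_abelian /= cent_cycle cycle_subG.
  by apply/cent1P; apply: commute_sym.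
have od : #[d] = 2.
  by apply: nt_prime_order => //; apply: contraNneq notGd => ->.
have oX : #|X| = #|G|.*2.
  rewrite defX TI_cardMg -?orderE ?od ?muln2 // setIC prime_TIg -?orderE ?od //.
  by rewrite cycle_subG.
have nt x y : <[x]> \x <[y]> = G -> x != 1 -> exact_dihedral_cyclic X.
  case/dprodP => _ defxy _ tixy ntx.
  have sxG : <[x]> \subset G by rewrite -defxy mulG_subl.
  have notxd : d \notin <[x]> by apply: contra notGd; apply: subsetP.
  have rot : rotation_subgroup (<[x]> <*> <[d]>) <[x]>.
    apply: rotations_join; rewrite ?cycle_cyclic // => g xg.
    by apply: invd; apply: subsetP xg.
  have [_ _ oA _] := rot.
  have syG : <[y]> \subset G by rewrite -defxy mulG_subr.
  have sGX : G \subset X by rewrite defX mulG_subl.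
  exists (<[x]> <*> <[d]>)%G, <[y]>%G; split; rewrite ?cycle_cyclic //.
    by apply: rotations_dihedral rot _; rewrite -orderE order_gt1.
  apply: exact_productI.
  - by rewrite join_subG (subset_trans sxG) //= defX mulG_subr.
  - exact: subset_trans syG sGX.
  (* A common element outside [<[x]>] would have the form [g * d] with [g] in [<[x]>], forcing [d]
     into [G]. *)
  - apply/trivgP; rewrite -tixy subsetI subsetIr andbT.
    apply/subsetP => z /setIP[Az yz]; apply: contraNT notGd => notxz.
    have Ad : d \in (<[x]> <*> <[d]>)%G.
      by rewrite /= mem_gen // inE cycle_id orbT.
    have : z \in (<[x]> <*> <[d]>)%G :\: <[x]> by rewrite inE notxz.
    rewrite (rotations_coset rot Ad) // => /rcosetP[g xg defz].
    have : z \in G by apply: subsetP yz.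
    by rewrite defz groupMl // (subsetP sxG).
  have oG : #|G| = (#[x] * #[y])%N by rewrite -defxy TI_cardMg.
  by rewrite oA oX oG -!orderE doubleMl.
have [b defb tb] := abelian_structure cGG.
have nt1 : G :=: 1 -> exact_dihedral_cyclic X.
  by move=> G1; move: Ga; rewrite G1 => /set1gP a1; rewrite a1 eqxx in nta.
have size_b : (size b <= 2)%N.
  rewrite -(size_map order) tb size_abelian_type // -grank_abelian //.
  have -> : G :=: <<[set a; c]>>.
    rewrite defG -norm_joinEr ?joing_idl ?joing_idr //.
    by rewrite cents_norm // cent_cycle cycle_subG; apply/cent1P/commute_sym.
  by rewrite (leq_trans (grank_min _)) // cards2; case: (a != c).
(* The basis may contain trivial entries; since [a] is nontrivial some entry is not, and it serves
   as the rotation. *)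
case: b defb size_b {tb} => [|x [|y []]] //; rewrite ?big_cons ?big_nil ?dprodg1.
- by move=> G1 _; apply: nt1.
- move=> defx _; have [x1 | ntx] := eqVneq x 1.
    by apply: nt1; rewrite -defx x1 cycle1.
  by apply: (nt x 1) => //; rewrite cycle1 dprodg1.
move=> defxy _; have [x1 | ntx] := eqVneq x 1; last exact: nt defxy ntx.
move: defxy; rewrite x1 cycle1 dprod1g => defy.
have [y1 | nty] := eqVneq y 1; first by apply: nt1; rewrite -defy y1 cycle1.
by apply: (nt y 1) => //; rewrite cycle1 dprodg1.
Qed.

Lemma rotations_cyclic (gT : finGroupType) (G C H : {group gT}) :
  rotation_subgroup G C -> H \subset G -> cyclic H -> ~~ (H \subset C) ->
  #|H| = 2.
Proof.
move=> [_ _ _ sq1] sHG /cyclicP[h defH]; rewrite defH cycle_subG => notCh.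
apply: nt_prime_order => //; last by apply: contraNneq notCh => ->.
by apply: sq1 => //; rewrite -cycle_subG -defH.
Qed.

(** In a quotient, [A] or [B] may shrink to order 2 and cease to be dihedral; it then serves as the
    cyclic factor. *)
Lemma rotation_product_exact (gT : finGroupType) (X A C B E : {group gT}) :
  rotation_subgroup A C -> rotation_subgroup B E -> X :=: A * B ->
  A :&: B = 1 -> exact_bidihedral X \/ exact_dihedral_cyclic X.
Proof.
move=> rotA rotB defX tiAB; have [_ _ oA _] := rotA; have [_ _ oB _] := rotB.
have defX' : X :=: B * A.
  by rewrite defX; apply/comm_group_setP; rewrite -defX groupP.
have cyc2 (H : {group gT}) : #|H| = 2 -> cyclic H.
  by move=> oH; rewrite prime_cyclic ?oH.
have card1 (H : {group gT}) : (#|H| <= 1)%N -> #|H| = 1%N.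
  by move=> H1; apply/eqP; rewrite eqn_leq H1 cardG_gt0.
have [C1 | C_gt1] := leqP #|C| 1; have [E1 | E_gt1] := leqP #|E| 1.
(* When both factors have order 2, [X] is a Klein four-group, hence itself dihedral, and the cyclic
   factor is trivial. *)
- rewrite (card1 C) // in oA; rewrite (card1 E) // in oB.
  have oX : #|X| = 4%N by rewrite defX TI_cardMg // oA oB.
  have cXX : abelian X by apply: (@card_p2group_abelian _ 2); rewrite ?oX.
  have [sAX sBX] : A \subset X /\ B \subset X.
    by rewrite {1}defX mulG_subl defX mulG_subr.
  have cAB : B \subset 'C(A) := subset_trans sBX (subset_trans cXX (centS sAX)).
  have [[t defB] [s defA]] := (cyclicP (cyc2 B oB), cyclicP (cyc2 A oA)).
  have rotX : rotation_subgroup (A <*> <[t]>)%G A.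
    apply: rotations_join; rewrite ?cyc2 //.
    - rewrite -cycle_subG -defB; apply/negP => sBA.
      by move: oB; rewrite -(setIidPr sBA) tiAB cards1.
    - by apply/eqP; rewrite -order_dvdn /order -defB oB.
    have Bt : t \in B by rewrite defB cycle_id.
    move=> x Ax; have -> : x ^ t = x.
      apply/conjg_fixP/commgP/commute_sym; exact: (centsP cAB t Bt x Ax).
    apply/eqP; rewrite eq_sym eq_invg_mul -[x * x]/(x ^+ 2) -order_dvdn.
    by rewrite (_ : 2 = #|A|) ?order_dvdG // oA.
  right; exists X, 1%G; split; rewrite ?cyclic1 //;
    last by split; rewrite ?mulg1 ?setIg1.
  have -> : X :=: A <*> <[t]> by rewrite -defB cent_joinEr.
  by apply: rotations_dihedral rotX _; rewrite oA.
- right; exists B, A; split; [exact: rotations_dihedral rotB _ | | ].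
    by rewrite cyc2 // oA card1.
  by split; rewrite // setIC.
- right; exists A, B; split; [exact: rotations_dihedral rotA _ | | by []].
  by rewrite cyc2 // oB card1.
left; exists A, B; split; [exact: rotations_dihedral rotA _ | | by []].
exact: rotations_dihedral rotB _.
Qed.

(** A subgroup of both rotation groups is normal in [A] and in [B], hence in [X], and the two images
    meet trivially. *)
Lemma rotation_product_quotient (gT : finGroupType) (X A C B E : {group gT}) :
  rotation_subgroup A C -> rotation_subgroup B E -> X :=: A * B ->
  A :&: B \subset C -> A :&: B \subset E ->
  A :&: B <| X /\ (exact_bidihedral (X / (A :&: B)) \/
                   exact_dihedral_cyclic (X / (A :&: B))).
Proof.
move=> rotA rotB defX sDC sDE.
have nDA := rotations_normal rotA sDC.
have nDB := rotations_normal rotB sDE.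
split.
  rewrite /normal subIset ?defX ?mulG_subl // mul_subG //; exact: normal_norm.
apply: (rotation_product_exact (rotations_quotient rotA sDC)
                               (rotations_quotient rotB sDE)).
  by rewrite /= defX quotientMl ?normal_norm.
by rewrite /= -quotientIG ?subsetIr // trivg_quotient.
Qed.

(** The intersection is cyclic but not inside [C], so a reflection of [A] generates it. Having order
    2, it meets [C] trivially, so [B :&: C = 1], and [#|B| * #|C| = #|X|] by counting. *)
Lemma central_cyclic_product_exact (gT : finGroupType)
    (X A C B E : {group gT}) :
  rotation_subgroup A C -> rotation_subgroup B E -> X :=: A * B ->
  (1 < #|E|)%N -> A :&: B \subset E -> ~~ (A :&: B \subset C) ->
  exact_dihedral_cyclic X.
Proof.
move=> rotA rotB defX E_gt1 sDE notsDC.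
have [sCA cycC oA _] := rotA; have [sEB cycE oB _] := rotB.
have oD : #|A :&: B| = 2.
  by apply: (rotations_cyclic rotA _ _ notsDC); rewrite ?subsetIl ?(cyclicS sDE).
exists B, C; split=> //; first exact: rotations_dihedral rotB E_gt1.
apply: exact_productI.
- by rewrite defX mulG_subr.
- by rewrite defX (subset_trans sCA) ?mulG_subl.
- rewrite -(setIidPr sCA) setIA (setIC B).
  by apply: prime_TIg; rewrite ?oD.
have := mul_cardG A B; rewrite oA oD -defX -doubleMl -muln2 => /eqP.
by rewrite eqn_mul2r /= => /eqP <-; rewrite mulnC.
Qed.

(** * Dihedral factors sharing a reflection *)

Section SharedReflection.

Variables (gT : finGroupType) (X A B : {group gT}) (a c : gT).
Hypotheses (rotA : rotation_subgroup A <[a]>) (rotB : rotation_subgroup B <[c]>).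
Hypothesis defX : X :=: A * B.

Lemma dihedral_mulC : X :=: B * A.
Proof. by rewrite defX; apply/comm_group_setP; rewrite -defX groupP. Qed.

Section Reflection.

Variable d : gT.
Hypotheses (Ad : d \in A) (Bd : d \in B) (notcd : d \notin <[c]>).

Lemma dihedral_mul_cycle : X :=: A * <[c]>.
Proof.
have defB : B :=: <[d]> * <[c]>.
  rewrite (rotations_mul rotB Bd notcd); apply/comm_group_setP.
  by rewrite -(rotations_mul rotB Bd notcd) groupP.
by rewrite defX defB mulgA mulGSid // cycle_subG.
Qed.

Lemma card_dihedral_mul_cycle :
  (#|A| * #[c] = #|X| * #|A :&: <[c]>|)%N.
Proof. by rewrite dihedral_mul_cycle mul_cardG. Qed.

Lemma card_dihedral_inter : #|A :&: B| = #|A :&: <[c]>|.*2.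
Proof.
have notsDc : ~~ (A :&: B \subset <[c]>).
  by apply/subsetPn; exists d; rewrite // inE Ad.
have [_ _ -> _] := rotations_sub rotB (subsetIr A B) notsDc.
by have [sCB _ _ _] := rotB; rewrite /= -setIA (setIidPr sCB).
Qed.

Lemma trivial_inter_exact : (1 < #[a])%N -> A :&: <[c]> = 1 ->
  exact_dihedral_cyclic X.
Proof.
move=> a_gt1 tiAc; exists A, <[c]>%G; split; rewrite ?cycle_cyclic //.
  exact: rotations_dihedral rotA a_gt1.
by split; first exact: dihedral_mul_cycle.
Qed.

(* In the index 2 case, the reflection [c * d] of [B] lies outside [A] and
   generates a complement. *)
Lemma index_le2_exact : (1 < #[a])%N -> (#|<[c]> : A| <= 2)%N ->
  exact_dihedral_cyclic X.
Proof.
move=> a_gt1; rewrite -indexgI => ic2.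
have dihA := rotations_dihedral rotA a_gt1.
have oX := card_dihedral_mul_cycle.
have sAX : A \subset X by rewrite defX mulG_subl.
have sBX : B \subset X by rewrite defX mulG_subr.
have [sCB _ _ sq1] := rotB.
have leX : (#|X| <= #|A| * 2)%N.
  rewrite -(leq_pmul2r (cardG_gt0 (A :&: <[c]>))) -oX -mulnA leq_mul2l.
  rewrite orderE -(Lagrange (subsetIr A <[c]>)) mulnC leq_mul2r /=.
  by rewrite (setIC (gval A)) ic2 !orbT.
have [Ac | notAc] := boolP (c \in A).
  exists A, 1%G; split; rewrite ?cyclic1 //.
  apply: exact_productI; rewrite ?sub1G ?setIg1 //.
  rewrite cards1 muln1 -(leq_pmul2r (cardG_gt0 (A :&: <[c]>))) -oX /=.
  by rewrite [A :&: _](setIidPr _) ?cycle_subG.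
have Bc : c \in B by rewrite -cycle_subG.
have notAcd : c * d \notin A by rewrite groupMr.
have ocd : #[c * d] = 2.
  apply: nt_prime_order => //; last by apply: contraNneq notAcd => ->.
  by apply: sq1; rewrite groupMl ?cycle_id.
exists A, <[c * d]>%G; split; rewrite ?cycle_cyclic //.
apply: exact_productI => //.
- by rewrite cycle_subG (subsetP sBX) ?groupM.
- by rewrite setIC; apply: prime_TIg; rewrite -?orderE ?ocd // cycle_subG.
by rewrite -orderE ocd.
Qed.

End Reflection.

End SharedReflection.

(** * The cases according to [Z = A :&: <[c]>] and parities *)

(** [B] is replaced by its subgroup [H] generated by [c ^+ 2] and [c * d]. Since [Z] has even index
    it lies in [<[c ^+ 2]>], so the reflections of [B] in [A], which form [Z :* d], avoid [H]. Thus
    [A :&: H = Z], and counting gives [X = A * H]. *)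
Lemma even_index_quotient (gT : finGroupType)
    (X A B : {group gT}) (a c d : gT) :
  rotation_subgroup A <[a]> -> rotation_subgroup B <[c]> -> X :=: A * B ->
  d \in A -> d \in B -> d \notin <[c]> -> A :&: <[c]> \subset <[a]> ->
  (1 < #|<[a]> : A :&: <[c]>|)%N -> (2 < #|<[c]> : A :&: <[c]>|)%N ->
  ~~ odd #|<[c]> : A :&: <[c]>| ->
  A :&: <[c]> <| X /\ exact_bidihedral (X / (A :&: <[c]>)).
Proof.
move=> rotA rotB defX Ad Bd notcd sZa ia ic even_ic.
have [saA _ _ _] := rotA; have [scB _ _ sq1] := rotB.
pose Z := (A :&: <[c]>)%G.
have sZc : Z \subset <[c]> := subsetIr _ _.
have nZA := rotations_normal rotA sZa; have nZB := rotations_normal rotB sZc.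
have sAX : A \subset X by rewrite defX mulG_subl.
have nZX : Z <| X.
  rewrite /normal (subset_trans (subsetIl A <[c]>)) // defX.
  by rewrite mul_subG ?normal_norm.
split=> //.
have oc : #[c] = (#|Z| * #|<[c]> : Z|./2).*2.
  by rewrite doubleMr even_halfK // Lagrange.
pose K := <[c ^+ 2]>%G.
have oK : #|K| = (#|Z| * #|<[c]> : Z|./2)%N.
  by rewrite -orderE orderXdiv oc -muln2 ?dvdn_mull // mulnK.
have sKc : K \subset <[c]> by apply: cycleX.
have sZK : Z \subset K.
  by rewrite -(cardSg_cyclic (cycle_cyclic c)) // oK dvdn_mulr.
have notKc : c \notin K.
  apply/negP; rewrite -cycle_subG => /subset_leq_card.
  rewrite -[#|<[c]>|]/(#[c]) oc -oK leqNgt -addnn -[X in (X < _)%N]addn0.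
  by rewrite ltn_add2l cardG_gt0.
have Bcd : c * d \in B by rewrite groupM // -cycle_subG.
have notccd : c * d \notin <[c]> by rewrite groupMl ?cycle_id.
have rotH : rotation_subgroup (K <*> <[c * d]>)%G K.
  apply: rotations_join; rewrite ?cycle_cyclic ?sq1 //.
    by apply: contra notccd; apply: subsetP.
  by move=> x Kx; apply: (rotations_conj rotB) => //; apply: subsetP Kx.
set H := (K <*> <[c * d]>)%G in rotH.
have sHB : H \subset B by rewrite join_subG !cycle_subG Bcd groupX // -cycle_subG.
have Hcd : c * d \in H by rewrite /= mem_gen // inE cycle_id orbT.
have tiAH : A :&: H = Z.
  apply/eqP; rewrite eqEsubset subsetI subsetIl andbC.
  rewrite (subset_trans sZK) ?joing_subl //=; apply/subsetP => z /setIP[Az Hz].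
  rewrite inE Az /=.
  (* A common reflection is [k * c * d] with [k] in [K]; then [k * c] lies in [A :&: <[c]> = Z],
     inside [K], and so [c] would lie in [K]. *)
  apply: contraR notKc => notcz.
  have : z \in H :\: K by rewrite inE Hz (contra (subsetP sKc z)).
  rewrite (rotations_coset rotH Hcd) ?(contra (subsetP sKc _)) //.
  case/rcosetP=> k Kk defz; rewrite -(groupMl _ Kk) (subsetP sZK) //.
  rewrite inE -(groupMr _ Ad) -mulgA -defz Az.
  by rewrite groupM ?cycle_id ?(subsetP sKc).
have oX := card_dihedral_mul_cycle rotB defX Ad Bd notcd.
have [_ _ oH _] := rotH.
have defXH : X :=: A * H.
  apply/eqP; rewrite eq_sym eqEcard mul_subG //=; last first.
    by rewrite (subset_trans sHB) // defX mulG_subr.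
  rewrite -(leq_pmul2r (cardG_gt0 Z)) -tiAH -mul_cardG oH tiAH -oX.
  by rewrite oK oc.
exists (A / Z)%G, (H / Z)%G; split.
- apply: rotations_dihedral (rotations_quotient rotA sZa) _.
  by rewrite /= card_quotient // (subset_trans saA) // normal_norm.
- apply: rotations_dihedral (rotations_quotient rotH sZK) _.
  rewrite /= card_quotient ?(subset_trans sKc) ?(subset_trans scB) ?normal_norm //.
  rewrite -divgS // oK mulKn //.
  (* The index is even and exceeds 2, so its half exceeds 1 and the image of [K] is nontrivial. *)
  by move: ic even_ic; case: #|<[c]> : _| => [|[|[|[|]]]].
split; first by rewrite /= defXH quotientMl ?normal_norm.
by rewrite /= -quotientGI ?subsetIl // tiAH trivg_quotient.
Qed.

(** [<[c ^+ 2]>] has odd order, so it meets the order 2 group [A :&: <[c]>] trivially. The lemma is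
    applied a second time with [A] and [B] exchanged. *)
Lemma odd_half_exact (gT : finGroupType) (X A B : {group gT}) (c d : gT) :
  rotation_subgroup B <[c]> -> X :=: A * B ->
  d \in A -> d \in B -> d \notin <[c]> -> #|A :&: <[c]>| = 2 ->
  odd #[c]./2 -> exact_product X A <[c ^+ 2]>.
Proof.
move=> rotB defX Ad Bd notcd oZ odd_c.
have [scB _ _ _] := rotB.
have even_c : ~~ odd #[c].
  by rewrite -dvdn2 -oZ cardSg ?subsetIr.
have oc2 : #|<[c ^+ 2]>| = #[c]./2.
  by rewrite -orderE orderXdiv ?dvdn2 // divn2.
have sc2c : <[c ^+ 2]> \subset <[c]> by apply: cycleX.
apply: exact_productI.
- by rewrite defX mulG_subl.
- by rewrite (subset_trans sc2c) // (subset_trans scB) // defX mulG_subr.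
- rewrite /= -(setIidPr sc2c) setIA.
  by apply: coprime_TIg; rewrite oZ oc2 coprime2n.
rewrite oc2 -(leq_pmul2r (isT : 0 < 2)%N) -oZ.
rewrite -(card_dihedral_mul_cycle rotB defX Ad Bd notcd) oZ -mulnA muln2.
by rewrite even_halfK.
Qed.

Lemma even_halves_structure (gT : finGroupType)
    (X A B : {group gT}) (a c d : gT) :
  rotation_subgroup A <[a]> -> rotation_subgroup B <[c]> -> X :=: A * B ->
  d \in A -> d \in B -> d \notin <[c]> -> ~~ (A :&: <[c]> \subset <[a]>) ->
  ~~ odd #[a]./2 -> ~~ odd #[c]./2 ->
  (exists2 G : {group gT}, <[c]> ><| <[a ^+ 2]> = G & dot_product X G <[a]>)
  /\ #[a] = 4.
Proof.
move=> rotA rotB defX Ad Bd notcd notsZa even_a even_c.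
have [saA _ oA sqA] := rotA; have [scB _ oB sqB] := rotB.
have oZ : #|A :&: <[c]>| = 2.
  apply: (rotations_cyclic rotA _ _ notsZa); rewrite ?subsetIl //.
  exact: cyclicS (subsetIr _ _) (cycle_cyclic c).
have oD : #|A :&: B| = 4.
  by rewrite (card_dihedral_inter rotB Ad Bd notcd) oZ.
have [e Ze notae] := subsetPn notsZa; have [Ae ce] := setIP Ze.
have oE : #|A :&: B :&: <[a]>| = 2.
  have notsDa : ~~ (A :&: B \subset <[a]>).
    by apply/subsetPn; exists e; rewrite // inE Ae (subsetP scB).
  have [_ _ oD' _] := rotations_sub rotA (subsetIl A B) notsDa.
  by apply: double_inj; rewrite -oD' oD.
(* If [A :&: B :&: <[a]>] were inside [<[c]>], it would equal [A :&: <[c]>] by order, which is not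
   inside [<[a]>]. *)
have [z /setIP[/setIP[Az Bz] az] notcz] :
    exists2 z, z \in A :&: B :&: <[a]> & z \notin <[c]>.
  apply/subsetPn; apply: contra notsZa => sEc.
  suff <- : A :&: B :&: <[a]> = A :&: <[c]> by rewrite subsetIr.
  apply/eqP; rewrite eqEcard oE oZ leqnn andbT subsetI sEc andbT.
  by rewrite -setIA subsetIl.
have zc : c ^ z = c^-1 by apply: (rotations_conj rotB) => //; apply: cycle_id.
have ea : a ^ e = a^-1 by apply: (rotations_conj rotA) => //; apply: cycle_id.
have oe : #[e] = 2.
  by apply: nt_prime_order; [| exact: sqA | apply: contraNneq notae => ->].
have oz : #[z] = 2.
  by apply: nt_prime_order; [| exact: sqB | apply: contraNneq notcz => ->].
have even2_a : ~~ odd #[a] by rewrite -dvdn2 -oz order_dvdG.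
have even2_c : ~~ odd #[c] by rewrite -dvdn2 -oe order_dvdG.
(* 4 divides the order of [c], so its involution is a power of [c ^+ 2]. *)
have ec2 : e \in <[c ^+ 2]>.
  rewrite -cycle_subG -(cardSg_cyclic (cycle_cyclic c)) ?cycleX ?cycle_subG //.
  by rewrite -!orderE oe orderXdiv ?dvdn2 // divn2.
have defXac : X :=: <[a]> * <[c]>.
  rewrite (dihedral_mul_cycle rotB defX Ad Bd notcd).
  by rewrite (rotations_mul rotA Ae notae) -mulgA mulSGid // cycle_subG.
(* Ito's identity is applied to [[~ a, e] = a ^- 2] and [[~ z, c] = c ^+ 2]. *)
have ac2 : commute (a ^+ 2) (c ^+ 2).
  have := abelian_mul_commute_comm (cycle_abelian a) (cycle_abelian c) defXac
            (cycle_id a) az ce (cycle_id c).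
  rewrite -(invgK [~ z, c]) invg_comm !commgEl ea zc -!invMg invgK.
  by move/commute_sym/commuteV; rewrite invgK => /commute_sym.
(* As a power of [c ^+ 2], [e] centralizes [a ^+ 2]; as a reflection of [A], it inverts it. *)
have a4 : a ^+ 4 = 1.
  case/cycleP: ec2 => j defe.
  have : (a ^+ 2) ^ e = a ^+ 2.
    by apply/conjg_fixP/commgP; rewrite defe; apply: commuteX.
  rewrite conjXg ea expgVn => /eqP; rewrite eq_invg_mul -expgD => /eqP //.
have oa : #[a] = 4.
  have : #[a] %| 4 by rewrite order_dvdn a4.
  have : (1 < #[a])%N by rewrite -oz dvdn_leq ?order_gt0 ?order_dvdG.
  by move: even_a even2_a; case: #[a] => [|[|[|[|[|k]]]]] // _ _ _ /dvdn_leq.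
split=> //.
have defz : <[a ^+ 2]> = <[z]>.
  apply/eqP; rewrite (eq_subG_cyclic (cycle_cyclic a)) ?cycleX ?cycle_subG //.
  by rewrite -!orderE oz orderXdiv oa.
have tiez : <[c]> :&: <[z]> = 1.
  by rewrite setIC prime_TIg -?orderE ?oz // cycle_subG.
have ncz : <[z]> \subset 'N(<[c]>).
  rewrite cycle_subG (subsetP _ z Bz) // normal_norm //.
  exact: rotations_normal rotB (subxx _).
exists (<[c]> <*> <[z]>)%G; first by rewrite defz sdprodEY.
have sGX : <[c]> <*> <[z]> \subset X.
  rewrite join_subG {1}defXac mulG_subr cycle_subG.
  by rewrite (subsetP _ z Bz) // defX mulG_subr.
have oG : #|<[c]> <*> <[z]>| = #[c].*2.
  by rewrite norm_joinEr // TI_cardMg // -!orderE oz muln2.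
split.
- apply/eqP; rewrite eqEsubset mul_subG //; last by rewrite defXac mulG_subl.
  have -> : X :=: <[c]> * <[a]>.
    by rewrite defXac; apply/comm_group_setP; rewrite -defXac groupP.
  by rewrite mulSg ?joing_subl.
(* Here [#|A| = 8] and [#|A :&: <[c]>| = 2] give [#|X| = 4 * #[c]], twice the order of [G]. *)
- apply: index2_normal => //; rewrite -divgS // oG.
  have := card_dihedral_mul_cycle rotB defX Ad Bd notcd.
  rewrite oA -orderE oa oZ -[4.*2]/(4 * 2)%N mulnAC => /eqP.
  rewrite eqn_mul2r /= => /eqP <-.
  by rewrite -mul2n -(mulnA 2 2) mulnK ?muln_gt0 ?order_gt0.
by move=> h _; exists 0%R; rewrite /= group1.
Qed.

(** Modulo [Z] the rotations commute, so [k = [~ a, c]] lies in [Z] and commutes with [a] and [c].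
    It has order dividing both 2 and the odd index of [Z] in [<[a]>], so it is trivial; then [d]
    inverts the abelian group generated by [a] and [c]. *)
Lemma odd_index_exact (gT : finGroupType) (X A B : {group gT}) (a c d : gT) :
  rotation_subgroup A <[a]> -> rotation_subgroup B <[c]> -> X :=: A * B ->
  d \in A -> d \in B -> d \notin <[a]> -> d \notin <[c]> ->
  A :&: <[c]> \subset <[a]> -> (1 < #[a])%N ->
  odd #|<[a]> : A :&: <[c]>| -> odd #|<[c]> : A :&: <[c]>| ->
  exact_dihedral_cyclic X.
Proof.
move=> rotA rotB defX Ad Bd notad notcd sZa a_gt1 odd_a odd_c.
have [saA _ _ sqA] := rotA; have [scB _ _ _] := rotB.
have [Aa Bc] : a \in A /\ c \in B by rewrite -!cycle_subG.
pose Z := (A :&: <[c]>)%G.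
have sZc : Z \subset <[c]> := subsetIr _ _.
have nZA := rotations_normal rotA sZa; have nZB := rotations_normal rotB sZc.
have [nZa nZc] : a \in 'N(Z) /\ c \in 'N(Z).
  by rewrite (subsetP (normal_norm nZA)) // (subsetP (normal_norm nZB)).
have nZd : d \in 'N(Z) by rewrite (subsetP (normal_norm nZA)).
have ad : a ^ d = a^-1 by apply: (rotations_conj rotA); rewrite ?cycle_id.
have cd : c ^ d = c^-1 by apply: (rotations_conj rotB); rewrite ?cycle_id.
have defXc := dihedral_mul_cycle rotB defX Ad Bd notcd.
have qcyc x : x \in 'N(Z) -> Z \subset <[x]> -> (<[coset Z x]> = <[x]> / Z) *
    (#[coset Z x] = #|<[x]> : Z|).
  move=> nZx sZx; rewrite orderE -quotient_cycle // card_quotient //.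
  by rewrite cycle_subG.
have ka : [~ a, c] \in Z.
  apply: coset_idr; first exact: groupR.
  rewrite morphR //; apply/eqP/commgP.
  apply: (@odd_rotations_commute _ (X / Z)%G (A / Z)%G _ _ (coset Z d)).
  - have -> : <[coset Z a]>%G = (<[a]> / Z)%G by apply: val_inj; rewrite /= qcyc.
    exact: rotations_quotient.
  - exact: mem_quotient.
  - rewrite qcyc //; apply: contra notad => qd.
    rewrite -(quotientGK (normalS sZa saA nZA)) mem_morphpre //.
  - by rewrite /= defXc qcyc // quotientMl ?normal_norm.
  - by rewrite qcyc //= -quotientIG // trivg_quotient.
  - by rewrite -morphJ // cd morphV.
  - by rewrite qcyc.
  by rewrite qcyc.
have cent_k x : Z \subset <[x]> -> commute x [~ a, c].
  move=> sZx; apply: (centsP (cycle_abelian x)); rewrite ?cycle_id //.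
  exact: subsetP ka.
have [cak cck] : commute a [~ a, c] /\ commute c [~ a, c] by split; apply: cent_k.
have kd : [~ a, c] ^ d = [~ a, c]^-1.
  by apply: (rotations_conj rotA) => //; apply: subsetP ka.
(* [d] sends [k] to [[~ a^-1, c^-1]], a conjugate of [k] by an element that centralizes it. *)
have kd' : [~ a, c] ^ d = [~ a, c].
  rewrite conjRg ad cd.
  have -> : [~ a^-1, c^-1] = [~ a, c] ^ (c * a)^-1.
    by rewrite !commgEl !conjgE !invMg !invgK !mulgA mulgK mulgV mul1g.
  apply/conjg_fixP/commgP; apply: commuteV; apply: commuteM; exact: commute_sym.
have k1 : [~ a, c] = 1.
  have k2 : #[[~ a, c]] %| 2.
    by rewrite order_dvdn expgS expg1 -{1}kd' kd mulVg.
  (* The corresponding power of [k] is the commutator of [c] with a power of [a] that lies in [Z],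
     hence in [<[c]>]. *)
  have kn : #[[~ a, c]] %| #|<[a]> : Z|.
    rewrite order_dvdn -commXg //; apply/commgP/commute_sym.
    apply: (centsP (cycle_abelian c)); rewrite ?cycle_id // (subsetP sZc) //.
    apply: coset_idr; first exact: groupX.
    by rewrite morphX // -(qcyc a nZa sZa) expg_order.
  apply/eqP; rewrite -order_eq1 -dvdn1.
  suff <- : gcdn 2 #|<[a]> : Z| = 1%N by rewrite dvdn_gcd k2.
  by apply/eqP; rewrite -/(coprime _ _) coprime2n.
have cac : commute a c by apply/commgP/eqP.
have cacs : <[c]> \subset 'N(<[a]>).
  by rewrite cents_norm // cent_cycle cycle_subG; apply/cent1P/commute_sym.
apply: (@inverted_abelian_exact _ X (<[a]> <*> <[c]>)%G a c d) => //.
- by rewrite -order_gt1.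
- exact: sqA.
- by rewrite /= norm_joinEr.
(* If [d = u * v] with [u] in [<[a]>] and [v] in [<[c]>], then [v] lies in [Z], hence in [<[a]>],
   and so does [d]. *)
- rewrite /= norm_joinEr //; apply: contra notad => /mulsgP[u v au cv defd].
  rewrite defd groupMl // (subsetP sZa) // inE cv andbT.
  by rewrite -(groupMl _ (subsetP saA u au)) -defd.
have -> : gval X = <[c]> * <[a]> * <[d]>.
  rewrite -mulgA -(rotations_mul rotA Ad notad) defXc.
  by apply/comm_group_setP; rewrite -defXc groupP.
rewrite /= norm_joinEr //; congr (_ * _).
by apply/esym/comm_group_setP; rewrite -norm_joinEr // groupP.
Qed.

(** * From the presentations to the classification *)

(** The relations only bound the order of [a] by [n]. The group order [n.*2] then keeps [b] out of
    [<[a]>] and makes the order of [a] exactly [n]. *)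
Lemma rotations_of_presentation (gT : finGroupType) (a b : gT) (n : nat) :
  (2 <= n)%N -> a ^+ n = 1 -> b ^+ 2 = 1 -> a ^ b = a^-1 ->
  <<[set a; b]>> \isog 'D_(n.*2) ->
  rotation_subgroup <<[set a; b]>>%G <[a]> /\ (1 < #[a])%N.
Proof.
move=> n2 an b2 ab isoab.
have oA : #|<<[set a; b]>>| = n.*2 by rewrite (card_isog isoab) card_dihedral.
have lean : (#[a] <= n)%N by rewrite dvdn_leq ?order_dvdn ?an // ltnW.
have notab : b \notin <[a]>.
  apply: contraTN lean => ab'; rewrite -ltnNge.
  have : <<[set a; b]>> \subset <[a]>.
    by rewrite gen_subG subUset !sub1set cycle_id.
  move/subset_leq_card; rewrite oA; apply: leq_trans.
  by rewrite -addnn -[X in (X < _)%N]addn0 ltn_add2l ltnW.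
have rot : rotation_subgroup (<[a]> <*> <[b]>)%G <[a]>.
  apply: rotations_join; rewrite ?cycle_cyclic // => _ /cycleP[i ->].
  by rewrite conjXg ab expgVn.
have eqA : <<[set a; b]>>%G = (<[a]> <*> <[b]>)%G.
  by apply: val_inj; rewrite /= joing_idl joing_idr.
rewrite eqA; split=> //; have [_ _ + _] := rot.
by rewrite -eqA oA => /double_inj; rewrite -orderE => <-.
Qed.

Lemma shared_reflection_exact (gT : finGroupType)
    (X A B : {group gT}) (a c d : gT) :
  rotation_subgroup A <[a]> -> rotation_subgroup B <[c]> -> X :=: A * B ->
  d \in A -> d \in B -> d \notin <[c]> -> (1 < #[a])%N -> (1 < #[c])%N ->
  A :&: <[c]> \subset <[a]> ->
  A :&: <[c]> <| X /\ exact_bidihedral (X / (A :&: <[c]>)) \/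
  exact_dihedral_cyclic X.
Proof.
move=> rotA rotB defX Ad Bd notcd a_gt1 c_gt1 sZa.
have [saA _ _ _] := rotA; have [scB _ _ _] := rotB.
have defX' := dihedral_mulC defX.
have oD := card_dihedral_inter rotB Ad Bd notcd.
have [sDa | /subsetPn[d' /setIP[Ad' Bd'] notad']] := boolP (A :&: B \subset <[a]>).
  right; apply: (trivial_inter_exact rotA rotB defX Ad Bd) => //.
  have oD2 : #|A :&: B| = 2.
    apply: (rotations_cyclic rotB); rewrite ?subsetIr //.
      exact: cyclicS sDa (cycle_cyclic a).
    by apply/subsetPn; exists d; rewrite // inE Ad.
  apply/eqP; rewrite trivg_card1; move: oD; rewrite oD2 /=.
  by case: #|A :&: <[c]>| => [|[|k]].
(* Both have index 2 in [A :&: B], which has elements outside [<[a]>] and outside [<[c]>]. The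
   situation is now symmetric in [A] and [B]. *)
have ZE : B :&: <[a]> = A :&: <[c]>.
  apply/eqP; rewrite eq_sym eqEcard subsetI sZa andbT subIset ?scB ?orbT //=.
  rewrite -leq_double -(card_dihedral_inter rotA Bd' Ad' notad') setIC.
  by rewrite oD.
have notad : d \notin <[a]>.
  apply: contra notcd => ad; suff : d \in A :&: <[c]> by case/setIP.
  by rewrite -ZE inE Bd.
have [ic | ic] := leqP #|<[c]> : A :&: <[c]>| 2.
  right; apply: (index_le2_exact rotA rotB defX Ad Bd) => //.
  by rewrite -indexgI setIC.
have [ia | ia] := leqP #|<[a]> : A :&: <[c]>| 2.
  right; apply: (index_le2_exact rotB rotA defX' Bd Ad) => //.
  by rewrite -indexgI setIC ZE.
have [odd_c | even_c] := boolP (odd #|<[c]> : A :&: <[c]>|); last first.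
  by left; apply: (even_index_quotient rotA rotB defX Ad Bd) => //; apply: ltnW.
have [odd_a | even_a] := boolP (odd #|<[a]> : A :&: <[c]>|); last first.
  left; rewrite -ZE; apply: (even_index_quotient rotB rotA defX' Bd Ad notad);
    by rewrite ?ZE ?subsetIr // ltnW.
by right; apply: (odd_index_exact rotA rotB defX Ad Bd).
Qed.

Theorem theorem6p1 (gT : finGroupType) (X : {group gT}) (a b c d : gT)
    (n m : nat) (n_ge2 : (2 <= n)%N) (m_ge2 : (2 <= m)%N)
    (an1 : a ^+ n = 1) (b21 : b ^+ 2 = 1) (ab : a ^ b = a^-1)
    (cm1 : c ^+ m = 1) (d21 : d ^+ 2 = 1) (cd : c ^ d = c^-1)
    (isoab : <<[set a; b]>> \isog 'D_(n.*2))
    (isocd : <<[set c; d]>> \isog 'D_(m.*2))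
    (defX : X :=: <<[set a; b]>> * <<[set c; d]>>) :
  [\/ (* (1) *)
      exact_product X <<[set a; b]>> <<[set c; d]>>,
      (* (2) *)
      [/\ <<[set a; b]>> :&: <<[set c; d]>> <> 1,
          <<[set a; b]>> :&: <<[set c; d]>> \subset <[c]>
        & (* (a) *)
          (<<[set a; b]>> :&: <<[set c; d]>> <| X /\
            (exact_bidihedral (X / (<<[set a; b]>> :&: <<[set c; d]>>)) \/
             exact_dihedral_cyclic (X / (<<[set a; b]>> :&: <<[set c; d]>>)))) \/
          (* (b) *)
          exact_dihedral_cyclic X]
    | (* (3) *)
      exists c1 d1 : gT,
        [/\ d1 \in <<[set c; d]>> :\: <[c]>,
            c1 \in <[c]>,
            <[c1]> = <<[set a; b]>> :&: <[c]>,
            <<[set a; b]>> :&: <<[set c; d]>> = <<[set c1; d1]>>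
          & [\/ (* (a) *)
                <[c1]> <| X /\
                  (exact_bidihedral (X / <[c1]>) \/ dihedral (X / <[c1]>)),
                (* (b) *)
                exact_dihedral_cyclic X,
                (* (c) *)
                (exists2 G : {group gT},
                   <[c]> ><| <[a ^+ 2]> = G & dot_product X G <[a]>) /\
                  #[a] = 4
              | (* (d) *)
                [/\ dihedral <<[set a; b]>>, cyclic <[c ^+ 2]>
                  & exact_product X <<[set a; b]>> <[c ^+ 2]>]]]].
Proof.
have [rotA a_gt1] := rotations_of_presentation n_ge2 an1 b21 ab isoab.
have [rotB c_gt1] := rotations_of_presentation m_ge2 cm1 d21 cd isocd.
set A := <<[set a; b]>>%G in rotA *; set B := <<[set c; d]>>%G in rotB *.
rewrite -[<<[set a; b]>>]/(gval A) -[<<[set c; d]>>]/(gval B).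
have {}defX : X :=: A * B := defX.
have [D1 | ntD] := eqVneq (A :&: B) 1; first by constructor 1.
have [saA _ _ _] := rotA; have [scB _ _ _] := rotB.
have [sDc | notsDc] := boolP (A :&: B \subset <[c]>).
  constructor 2; split=> //; first exact/eqP.
  have [sDa | notsDa] := boolP (A :&: B \subset <[a]>).
    by left; apply: rotation_product_quotient rotA rotB defX sDa sDc.
  by right; apply: central_cyclic_product_exact rotA rotB defX c_gt1 sDc notsDa.
constructor 3.
have [d1 /setIP[Ad1 Bd1] notcd1] := subsetPn notsDc.
have defX' := dihedral_mulC defX.
have [c1 defZ] : exists c1, A :&: <[c]> = <[c1]>.
  by apply/cyclicP; apply: cyclicS (subsetIr _ _) (cycle_cyclic c).
exists c1, d1; split=> //.
- by rewrite inE notcd1.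
- by rewrite -cycle_subG -defZ subsetIr.
- have Dd1 : d1 \in (A :&: B)%G by rewrite inE Ad1.
  rewrite -[LHS]/(gval (A :&: B)%G).
  have rotD := rotations_sub rotB (subsetIr A B) notsDc.
  have notD : d1 \notin (A :&: B)%G :&: <[c]>.
    by rewrite inE negb_and notcd1 orbT.
  rewrite (rotations_mul rotD Dd1 notD) /= -setIA (setIidPr scB) defZ.
  rewrite -norm_joinEr ?joing_idl ?joing_idr // cycle_subG.
  have nZB : (A :&: <[c]>)%G <| B by apply: rotations_normal rotB (subsetIr _ _).
  by move: nZB; rewrite /normal /= defZ => /andP[_ /subsetP]; apply.
rewrite -defZ.
have [sZa | notsZa] := boolP (A :&: <[c]> \subset <[a]>).
  have [[nZX bi] | ] := shared_reflection_exact rotA rotB defX Ad1 Bd1 notcd1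
                          a_gt1 c_gt1 sZa.
    by constructor 1; split=> //; left.
  by constructor 2.
have oZ : #|A :&: <[c]>| = 2.
  apply: (rotations_cyclic rotA _ _ notsZa); rewrite ?subsetIl //.
  exact: cyclicS (subsetIr _ _) (cycle_cyclic c).
have [odd_c | even_c] := boolP (odd #[c]./2).
  constructor 4; split; [exact: rotations_dihedral rotA a_gt1 | exact: cycle_cyclic |].
  exact: (odd_half_exact rotB defX Ad1 Bd1 notcd1 oZ).
have [odd_a | even_a] := boolP (odd #[a]./2).
  constructor 2; exists B, <[a ^+ 2]>%G.
  split; [exact: rotations_dihedral rotB c_gt1 | exact: cycle_cyclic |].
  (* After exchanging [A] and [B], the shared reflection must lie outside [<[a]>]; the involution
     [e] of [<[c]>] does. [B :&: <[a]>] has order 2 because it too is half of [A :&: B]. *)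
  have [e Ze notae] := subsetPn notsZa; have [Ae ce] := setIP Ze.
  have Be : e \in B by apply: subsetP ce.
  apply: (odd_half_exact rotA defX' Be Ae notae) => //.
  apply: double_inj; rewrite -(card_dihedral_inter rotA Be Ae notae) setIC.
  by rewrite (card_dihedral_inter rotB Ad1 Bd1 notcd1) oZ.
constructor 3.
exact: (even_halves_structure rotA rotB defX Ad1 Bd1 notcd1 notsZa).
Qed.
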